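(* Let $f,g,F=f+g$ and $\{D^k\},\{\epsilon^k\}$ be as in the context, with $\epsilon^k\le\overline\epsilon<\frac mL$ for all $k$. Let $\{x^k\}$ be a sequence generated by the VBPG method. Then: (i) the sequence $\{F(x^k)\}$ is strictly decreasing (unless $x^k\in\overline{\mathbf X}_P$ for some $k$); (ii) $\sum_{k=0}^\infty\|x^k-x^{k+1}\|^2<+\infty$; (iii) $\{x^k\}$ is bounded, and any cluster point $\overline x$ of $\{x^k\}$ is a limiting critical point of $F$, that is, $0\in\partial_LF(\overline x)$; (iv) $\lim_{k\to\infty}\mathrm{dist}(x^k,\overline{\mathbf X}_L)=0$; (v) if it is further assumed that $D^k=D$ for all $k$ and $\epsilon^k\to\hat\epsilon\in\left(\underline\epsilon,\frac{m}{2L}\right)$, then any cluster point $\overline x$ of $\{x^k\}$ is a proximal critical point of $F$, that is, $0\in\partial_PF(\overline x)$, and $\lim_{k\to\infty}\mathrm{dist}(x^k,\overline{\mathbf X}_P)=0$.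
   Context: Assumptions on $f,g$: $f:\mathbb{R}^n\to(-\infty,\infty]$ is a proper lower semicontinuous (possibly nonconvex) function, differentiable on $\mathrm{dom} f$, with $\mathrm{dom} f$ convex and $\nabla f$ $L$-Lipschitz continuous on $\mathrm{dom} f$; $g:\mathbb{R}^n\to(-\infty,\infty]$ is proper, lower semicontinuous (possibly nonconvex and nonsmooth), continuous on $\mathrm{dom} g$, and $\mathrm{dom} g$ is convex; $F=f+g$ is level-bounded, i.e. $\{x: F(x)\le r\}$ is bounded (possibly empty) for every $r\in\mathbb{R}$. Variable Bregman distances: for each $k$, $K^k:\mathbb{R}^n\to\mathbb{R}$ is strongly convex with modulus $m^k\ge m>0$ and $\nabla K^k$ is $M^k$-Lipschitz with $M^k\le M$; $D^k(x,y)=K^k(y)-[K^k(x)+\langle\nabla K^k(x),y-x\rangle]$; and $0<\underline\epsilon\le\epsilon^k\le\overline\epsilon$. VBPG method: from $x^0\in\mathbb{R}^n$, for $k=0,1,\dots$ choose $x^{k+1}\in\arg\min_{x\in\mathbb{R}^n}\{\langle\nabla f(x^k),x-x^k\rangle+g(x)+\frac1{\epsilon^k}D^k(x^k,x)\}$. Subdifferentials: $\partial_P\psi(\bar x)=\{\xi:\exists\rho>0,\eta>0\text{ s.t. }\psi(x)\ge\psi(\bar x)+\langle\xi,x-\bar x\rangle-\rho\|x-\bar x\|^2\ \forall x\in\mathbb{B}(\bar x;\eta)\}$ (proximal); the Fréchet subdifferential $\partial_F\psi(\bar x)$ is the set of $\xi$ with $\liminf_{y\to\bar x,y\ne\bar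 x}\frac{1}{\|y-\bar x\|}[\psi(y)-\psi(\bar x)-\langle\xi,y-\bar x\rangle]\ge0$; the limiting subdifferential is $\partial_L\psi(\bar x)=\{\xi:\exists x_n\to\bar x,\ \psi(x_n)\to\psi(\bar x),\ \xi_n\in\partial_F\psi(x_n),\ \xi_n\to\xi\}$. $\overline{\mathbf X}_P=\{x:0\in\partial_PF(x)\}$ (proximal critical points) and $\overline{\mathbf X}_L=\{x:0\in\nabla f(x)+\partial_Lg(x)\}$ (limiting critical points). $\mathrm{dist}(x,C)=\inf_{z\in C}\|x-z\|$. *)

(* Defs.v *)
From HB Require Import structures.
From mathcomp Require Import all_boot all_order all_algebra.
From mathcomp Require Import all_classical all_reals all_analysis.
Set Implicit Arguments.
Unset Strict Implicit.
Unset Printing Implicit Defensive.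
Import Order.TTheory GRing.Theory Num.Theory.
Import numFieldNormedType.Exports.
Local Open Scope classical_set_scope.
Local Open Scope ring_scope.

Section Definitions.
Variables (R : realType) (n : nat).
Local Notation V := 'rV[R]_n.
Implicit Types (A C : set V) (psi f g Q : V -> \bar R) (h K : V -> R).
Implicit Types (x y v xi : V).

(* The library norm on 'rV[R]_n is the sup norm. It induces the usual topology
   and the usual bounded sets, but moduli and Lipschitz constants below refer
   to the Euclidean norm. *)
Definition dot x y : R := \sum_(i < n) x 0 i * y 0 i.
Definition enorm x : R := Num.sqrt (dot x x).

Definition edom psi : set V := [set x | (psi x < +oo)%E].

Definition eproper psi : Prop :=
  (forall x, -oo < psi x)%E /\ edom psi !=set0.

Definition level_bounded psi : Prop :=
  forall r : R, bounded_set [set x | (psi x <= r%:E)%E].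

Definition lipschitz_within (L : R) A (G : V -> V) : Prop :=
  forall x y, A x -> A y -> enorm (G x - G y) <= L * enorm (x - y).

(* v is a gradient of h at x, the increments being taken inside A. If x is
   interior to A this is Frechet differentiability at x with gradient v. *)
Definition is_gradient_within A h x v : Prop :=
  (h y - h x - dot v (y - x)) / enorm (y - x) @[y --> within A x^'] --> (0 : R).

(* The domain of f need not be open, so that "differentiable on dom f" is read
   relatively to dom f. *)
Definition gradient_on_dom f (gradf : V -> V) : Prop :=
  forall x, edom f x -> is_gradient_within (edom f) (fine \o f) x (gradf x).

Definition grad K x : V := \row_(i < n) 'D_(delta_mx 0 i) K x.

Definition strongly_convex (m : R) K : Prop :=
  forall x y (t : R), 0 <= t <= 1 ->
    K (t *: x + (1 - t) *: y) <=
      t * K x + (1 - t) * K y - m / 2 * (t * (1 - t)) * enorm (x - y) ^+ 2.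

Definition bregman K x y : R := K y - (K x + dot (grad K x) (y - x)).

Definition argmin Q : set V := [set x | forall y, (Q x <= Q y)%E].

Definition vbpg_objective (gradf : V -> V) g (D : V -> V -> R) (eps : R) x y :
    \bar R :=
  ((dot (gradf x) (y - x))%:E + g y + (eps^-1 * D x y)%:E)%E.

(* Step k uses the gradient of f at x k, which is meaningful only on dom f. *)
Definition vbpg f (gradf : V -> V) g (D : nat -> V -> V -> R) (eps : nat -> R)
    (x : nat -> V) : Prop :=
  forall k, edom f (x k) /\
    argmin (vbpg_objective gradf g (D k) (eps k) (x k)) (x k.+1).

(* As usual, subdifferentials are empty outside the domain. *)
Definition subdiffP psi x : set V := [set xi | edom psi x /\
  exists rho eta : R, [/\ 0 < rho, 0 < eta &
    forall y, enorm (y - x) <= eta ->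
      (psi x + (dot xi (y - x) - rho * enorm (y - x) ^+ 2)%:E <= psi y)%E]].

Definition subdiffF psi x : set V := [set xi | edom psi x /\
  (0 <= limf_einf (fun y => (enorm (y - x))^-1%:E *
                     (psi y - psi x - (dot xi (y - x))%:E)) x^')%E].

Definition subdiffL psi x : set V := [set xi | edom psi x /\
  exists (u w : nat -> V),
    [/\ u k @[k --> \oo] --> x,
        psi (u k) @[k --> \oo] --> psi x,
        (forall k, subdiffF psi (u k) (w k)) &
        w k @[k --> \oo] --> xi]].

Definition prox_critical psi : set V := [set x | subdiffP psi x 0].

Definition lim_critical f (gradf : V -> V) g : set V :=
  [set x | edom f x /\ exists2 xi, subdiffL g x xi & gradf x + xi = 0].

(* Valued in \bar R: the distance to the empty set is +oo. *)
Definition edistance x C : \bar R :=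
  ereal_inf [set (enorm (x - z))%:E | z in C].

End Definitions.

(* Main.v *)
Require Import Defs.
From HB Require Import structures.
From mathcomp Require Import all_boot all_order all_algebra.
From mathcomp Require Import all_classical all_reals all_analysis.
From mathcomp Require Import ring lra.
Set Implicit Arguments.
Unset Strict Implicit.
Unset Printing Implicit Defensive.
Import Order.TTheory GRing.Theory Num.Theory.
Import numFieldNormedType.Exports.
Local Open Scope classical_set_scope.
Local Open Scope ring_scope.

(** The proof rests on one inequality.  Write [x] for [x k], [z] for [x k.+1].
    The point [z] minimizes the linearized and regularized model, and
    [0 <= bregman (K k) x y <= M * enorm (y - x) ^+ 2]; hence, with
    [C = `|M| / elow] and for every [y],
    [[
      g z <= g y + dot (gradf x) (y - z) + C * enorm (y - x) ^+ 2
    ]]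
    ([vbpg_step_minorant]).  If consecutive iterates come together, then at a
    cluster point [p] both [x] and [z] tend to [p] along a subsequence, [gradf]
    is continuous on the domain of [f] and [g] is lower semicontinuous, so the
    inequality survives with [x = z = p] ([cluster_minorant]).  It then says
    that [- gradf p] is a proximal subgradient of [g] at [p]; adding the lower
    quadratic bound on [f] that comes from the Lipschitz gradient, the linear
    terms cancel and [0] is a proximal subgradient of [f + g]
    ([minorant_critical]).  Proximal subgradients are Frechet subgradients, and
    these are limiting ones, so every cluster point is critical in all the
    senses at once.

    Consecutive iterates come together by descent.  Testing minimality against
    [y = x], strong convexity of the kernel gains [m / (2 * ebar)] and the upper
    quadratic bound on [f] costs [L / 2], so each step lowers [f + g] by a fixed
    positive multiple of the squared step length ([vbpg_step_decrease]).  The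
    iterates stay in a level set, hence are bounded; the value at any cluster
    point bounds the decreasing values from below; so the squared lengths are
    summable ([descent_summable]).  A step of length zero satisfies the
    displayed inequality with [x = z], which is why the decrease is strict away
    from critical points.

    Finally, the distance from a bounded sequence to any set containing all its
    cluster points tends to zero ([edistance_cvg0]). *)

(** * The Euclidean inner product and norm *)

Section Euclidean.
Variables (R : realType) (n : nat).
Implicit Types x y z u v : 'rV[R]_n.

Lemma dotC x y : dot x y = dot y x.
Proof. by apply: eq_bigr => i _; rewrite mulrC. Qed.

Lemma dotDl x y z : dot (x + y) z = dot x z + dot y z.
Proof. by rewrite /dot -big_split; apply: eq_bigr => i _; rewrite mxE mulrDl. Qed.

Lemma dotZl a x y : dot (a *: x) y = a * dot x y.
Proof. by rewrite /dot mulr_sumr; apply: eq_bigr => i _; rewrite mxE mulrA. Qed.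

Lemma dotNl x y : dot (- x) y = - dot x y.
Proof. by rewrite -scaleN1r dotZl mulN1r. Qed.

Lemma dotBl x y z : dot (x - y) z = dot x z - dot y z.
Proof. by rewrite dotDl dotNl. Qed.

Lemma dotBr x y z : dot z (x - y) = dot z x - dot z y.
Proof. by rewrite !(dotC z) dotBl. Qed.

Lemma dotZr a x y : dot x (a *: y) = a * dot x y.
Proof. by rewrite dotC dotZl dotC. Qed.

Lemma dotNr x y : dot x (- y) = - dot x y.
Proof. by rewrite dotC dotNl dotC. Qed.

Lemma dot0l x : dot 0 x = 0.
Proof. by rewrite -[0](scale0r 0) dotZl mul0r. Qed.

Lemma dot0r x : dot x 0 = 0.
Proof. by rewrite dotC dot0l. Qed.

Lemma dot_ge0 x : 0 <= dot x x.
Proof. by apply: sumr_ge0 => i _; rewrite -expr2 sqr_ge0. Qed.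

Lemma enorm_ge0 x : 0 <= enorm x.
Proof. exact: sqrtr_ge0. Qed.

Lemma sqr_enorm x : enorm x ^+ 2 = dot x x.
Proof. by rewrite sqr_sqrtr// dot_ge0. Qed.

Lemma enorm0 : enorm (0 : 'rV[R]_n) = 0.
Proof. by rewrite /enorm dot0l sqrtr0. Qed.

Lemma enormN x : enorm (- x) = enorm x.
Proof. by rewrite /enorm dotNl dotNr opprK. Qed.

Lemma enorm_distC x y : enorm (x - y) = enorm (y - x).
Proof. by rewrite -enormN opprB. Qed.

Lemma enormZ a x : enorm (a *: x) = `|a| * enorm x.
Proof.
by rewrite /enorm dotZl dotZr mulrA -expr2 sqrtrM ?sqr_ge0// sqrtr_sqr.
Qed.

Lemma le_norm_enorm x : `|x| <= enorm x.
Proof.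
rewrite [leLHS]/Num.norm /= mx_normrE; apply/bigmax_leP.
split=> [|[i j] _ /=]; first exact: enorm_ge0.
rewrite ord1 -sqrtr_sqr ler_wsqrtr//.
rewrite /dot (bigD1 j)//= -expr2 lerDl.
by apply: sumr_ge0 => k _; rewrite -expr2 sqr_ge0.
Qed.

Lemma enorm_eq0 x : (enorm x == 0) = (x == 0).
Proof.
apply/eqP/eqP => [x0|->]; last exact: enorm0.
by apply/normr0_eq0/le_anti; rewrite normr_ge0 -x0 le_norm_enorm.
Qed.

(** Cauchy-Schwarz: [enorm y *: x - enorm x *: y] has nonnegative square norm. *)
Lemma dot_le_enorm x y : dot x y <= enorm x * enorm y.
Proof.
have [/eqP|x0] := eqVneq (enorm x) 0.
  by rewrite enorm_eq0 => /eqP ->; rewrite dot0l enorm0 mul0r.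
have [/eqP|y0] := eqVneq (enorm y) 0.
  by rewrite enorm_eq0 => /eqP ->; rewrite dot0r enorm0 mulr0.
have xp : 0 < enorm x by rewrite lt_neqAle eq_sym x0 enorm_ge0.
have yp : 0 < enorm y by rewrite lt_neqAle eq_sym y0 enorm_ge0.
have := dot_ge0 (enorm y *: x - enorm x *: y).
rewrite !(dotBl, dotBr, dotZl, dotZr) (dotC y x) -!sqr_enorm => H.
have : 0 <= (enorm x * enorm y) * (enorm x * enorm y - dot x y) by nra.
by rewrite pmulr_rge0 ?mulr_gt0// subr_ge0.
Qed.

Lemma norm_dot_le x y : `|dot x y| <= enorm x * enorm y.
Proof.
rewrite ler_norml lerNl -dotNl -(enormN x) dot_le_enorm (enormN x).
exact: dot_le_enorm.
Qed.

Lemma cvg_dot T (F : set_system T) (FF : Filter F) (u v : T -> 'rV[R]_n) a b :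
  u t @[t --> F] --> a -> v t @[t --> F] --> b ->
  dot (u t) (v t) @[t --> F] --> dot a b.
Proof.
move=> ua vb; apply: cvg_big => [|i _].
  by move=> [a' b']; exact: add_continuous.
apply: cvgM.
- apply: (@cvg_comp _ _ _ u (fun w : 'rV[R]_n => w 0 i)) ua _.
  exact: coord_continuous.
- apply: (@cvg_comp _ _ _ v (fun w : 'rV[R]_n => w 0 i)) vb _.
  exact: coord_continuous.
Qed.

Lemma cvg_enorm T (F : set_system T) (FF : Filter F) (u : T -> 'rV[R]_n) a :
  u t @[t --> F] --> a -> enorm (u t) @[t --> F] --> enorm a.
Proof.
move=> ua; apply: (@cvg_comp _ _ _ (fun t => dot (u t) (u t)) Num.sqrt).
  exact: (cvg_dot FF ua ua).
exact: sqrt_continuous.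
Qed.

Lemma enorm_cvg0 T (F : set_system T) (FF : Filter F) (u : T -> 'rV[R]_n) :
  enorm (u t) @[t --> F] --> (0 : R) -> u t @[t --> F] --> (0 : 'rV[R]_n).
Proof.
move=> u0; apply/norm_cvg0P; apply: (@squeeze_cvgr _ _ _ _ (fun=> 0)) u0 => //.
  by apply: nearW => t; rewrite normr_ge0 le_norm_enorm.
exact: cvg_cst.
Qed.

Lemma near_enorm_lt x (e : R) : 0 < e -> \forall y \near x, enorm (y - x) < e.
Proof.
move=> e0; have : enorm (y - x) @[y --> x] --> enorm (x - x).
  apply: (cvg_enorm (nbhs_filter x)).
  by apply: cvgB; [exact: cvg_id|exact: cvg_cst].
rewrite subrr enorm0 => /cvgr0Pnorm_lt/(_ e e0).
by apply: filterS => y; rewrite ger0_norm ?enorm_ge0.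
Qed.

End Euclidean.

(** * Quadratic bounds from a Lipschitz gradient *)

Section QuadraticBounds.
Variables (R : realType) (n : nat).
Implicit Types (A : set 'rV[R]_n) (h : 'rV[R]_n -> R).

(** The hypothesis on [phi] asks for derivative [psi] in the interior and
    one-sided derivatives at the ends of the unit interval: this is what a
    gradient relative to a convex set gives along a segment of that set.  The
    mean value theorem is applied to [phi] minus the claimed quadratic bound,
    whose slope is nonpositive. *)
Lemma first_order_le_quadratic (phi psi : R -> R) (C : R) :
  (forall t : R, 0 <= t <= 1 -> forall e : R, 0 < e -> \forall s \near t,
    0 <= s <= 1 -> `|phi s - phi t - (s - t) * psi t| <= e * `|s - t|) ->
  (forall t, 0 <= t <= 1 -> psi t - psi 0 <= C * t) ->
  phi 1 - phi 0 - psi 0 <= C / 2.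
Proof.
move=> dphi psi_le.
have phi_derive (t : R) : 0 < t < 1 -> is_derive t 1 phi (psi t).
  move=> /andP[t0 t1].
  have cvg_quot : h^-1 *: ((phi \o shift t) (h *: (1 : R)) - phi t)
      @[h --> 0^'] --> psi t.
    apply/cvgrPdist_le => e e0.
    have t01 : 0 <= t <= 1 by rewrite !ltW.
    have := dphi t t01 e e0; rewrite (near_shift 0) /= subr0 => dphi_t.
    have gt_near : \forall z \near (0 : R), - t < z < 1 - t.
      by apply: near_in_itvoo; rewrite in_itv/= oppr_lt0 t0 subr_gt0.
    rewrite near_withinE; near=> z => z0.
    rewrite scaler1 /=.
    have zt01 : 0 <= z + t <= 1.
      have /andP[] : - t < z < 1 - t by near: z.
      by move=> *; apply/andP; split; lra.
    have : `|phi (z + t) - phi t - (z + t - t) * psi t| <= e * `|z + t - t|.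
      by move: zt01; near: z.
    rewrite addrK => remainder_le.
    rewrite -(ler_pM2r (_ : 0 < `|z|)) ?normr_gt0// -normrM.
    rewrite mulrBl /GRing.scale /= mulrAC mulVf// mul1r distrC.
    by rewrite (mulrC (psi t)).
  by apply: DeriveDef; [exact: cvgP cvg_quot|exact: cvg_lim cvg_quot].
pose k t := phi t - psi 0 * t - C / 2 * t ^+ 2.
have k_derive (t : R) : t \in `]0, 1[%R ->
    is_derive t (1 : R) k (psi t - psi 0 - C * t).
  rewrite in_itv/= => /phi_derive phi_d.
  have -> : k = phi - psi 0 *: @idfun R - (C / 2) *: (@idfun R ^+ 2) by [].
  apply: is_derive_eq.
  by rewrite /GRing.scale /=; lra.
have k_cont : {within `[0, 1], continuous k}.
  apply/subspace_continuousP => t; rewrite /= in_itv/= => t01.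
  apply: cvgB; first apply: cvgB.
  - apply/cvgrPdist_le => e e0.
    pose B := 1 + `|psi t|.
    have B0 : 0 < B by rewrite ltr_pwDl.
    rewrite near_withinE; near=> s => /= /[!in_itv]/= s01.
    have h1 : `|s - t| <= e / B.
      rewrite distrC; near: s; apply: (@cvgr_dist_le _ _ _ (nbhs t)) => //.
      by rewrite divr_gt0.
    have h2 : `|phi s - phi t - (s - t) * psi t| <= 1 * `|s - t|.
      by move: s01; near: s; exact: dphi.
    rewrite distrC -[phi s - phi t](subrK ((s - t) * psi t)).
    rewrite (le_trans (ler_normD _ _))// normrM.
    rewrite (@le_trans _ _ (B * `|s - t|))//; first by rewrite /B; lra.
    by rewrite mulrC -ler_pdivlMr.
  - apply: cvg_within_filter; apply: cvgM; [exact: cvg_cst|exact: cvg_id].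
  - apply: cvg_within_filter; apply: cvgM; [exact: cvg_cst|exact: exprn_continuous].
have [c c01] := MVT ltr01 k_derive k_cont.
have := psi_le c; move: c01; rewrite in_itv/= => /andP[c0 c1].
rewrite (ltW c0) (ltW c1) => /(_ isT) slope_le.
by rewrite /k; lra.
Unshelve. all: by end_near.
Qed.

(** The quadratic bound with the sharp constant [L / 2], obtained on the segment
    from [x] to [y], where the slope differs from its initial value by at most
    [L * enorm (y - x) ^+ 2 * t] at time [t]. *)
Lemma lipschitz_gradient_quadratic A h G L x y :
  @convex_set R 'rV[R]_n A ->
  (forall z, A z -> is_gradient_within A h z (G z)) -> lipschitz_within L A G ->
  A x -> A y ->
  `|h y - h x - dot (G x) (y - x)| <= L / 2 * enorm (y - x) ^+ 2.
Proof.
move=> cvxA gradG lipG Ax Ay; set d := y - x; pose p (t : R) := x + t *: d.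
have p0 : p 0 = x by rewrite /p scale0r addr0.
have p1 : p 1 = y by rewrite /p scale1r addrC subrK.
have pB s t : p s - p t = (s - t) *: d.
  by rewrite /p opprD addrACA subrr add0r -scalerBl.
have pA t : 0 <= t <= 1 -> A (p t).
  move=> /andP[t0 t1].
  suff <- : t *: y + (1 - t) *: x = p t.
    exact: set_mem (cvxA y x (Itv01 t0 t1) (mem_set Ay) (mem_set Ax)).
  by rewrite scalerBl scale1r addrCA -scalerBr.
have remainder (t : R) : 0 <= t <= 1 -> forall e : R, 0 < e -> \forall s \near t,
    0 <= s <= 1 ->
    `|h (p s) - h (p t) - (s - t) * dot (G (p t)) d| <= e * `|s - t|.
  move=> t01 e e0.
  have [d0|d0] := eqVneq (enorm d) 0.
    move/eqP: d0; rewrite enorm_eq0 => /eqP d_eq0; near=> s => _.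
    by rewrite /p d_eq0 !scaler0 subrr dot0r mulr0 subr0 normr0 mulr_ge0// ltW.
  have dp : 0 < enorm d by rewrite lt_neqAle eq_sym d0 enorm_ge0.
  have /cvgr0Pnorm_le := gradG _ (pA _ t01).
  move=> /(_ (e / enorm d) (divr_gt0 e0 dp)); rewrite !near_withinE => quot_le.
  have p_cvg : p s @[s --> t] --> p t.
    by apply: cvgD; [exact: cvg_cst|apply: cvgZr_tmp; exact: cvg_id].
  near=> s => s01.
  have [->|st] := eqVneq s t; first by rewrite !subrr mul0r subr0 normr0 mulr0.
  have : `|(h (p s) - h (p t) - dot (G (p t)) (p s - p t)) / enorm (p s - p t)|
      <= e / enorm d.
    have : A (p s) by exact: pA.
    have : p s != p t.
      by rewrite -subr_eq0 -enorm_eq0 pB enormZ mulf_neq0// normr_eq0 subr_eq0.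
    by near: s; exact: p_cvg quot_le.
  rewrite pB dotZr enormZ normrM normfV normrM normr_id (ger0_norm (enorm_ge0 d)).
  rewrite ler_pdivrMr ?mulr_gt0// ?normr_gt0 ?subr_eq0//.
  by rewrite (mulrC `|s - t|) mulrA divfK.
have slope_lip t : 0 <= t <= 1 ->
    `|dot (G (p t)) d - dot (G (p 0)) d| <= L * enorm d ^+ 2 * t.
  move=> t01; rewrite -dotBl (le_trans (norm_dot_le _ _))//.
  have A0 : A (p 0) by rewrite p0.
  rewrite expr2 mulrA mulrAC ler_wpM2r ?enorm_ge0//.
  apply: (le_trans (lipG _ _ (pA _ t01) A0)).
  have /andP[t0 _] := t01.
  by rewrite pB subr0 enormZ (ger0_norm t0) mulrAC -mulrA.
rewrite mulrAC ler_norml; apply/andP; split.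
- have := @first_order_le_quadratic (fun t => - h (p t))
    (fun t => - dot (G (p t)) d) (L * enorm d ^+ 2).
  rewrite p0 p1 => neg_bound; suff : - h y - - h x - - dot (G x) d
      <= L * enorm d ^+ 2 / 2 by lra.
  apply: neg_bound => [t t01 e e0|t t01].
    have := remainder t t01 e e0; apply: filterS => s rem_s /rem_s.
    by rewrite -normrN; congr (`|_| <= _); ring.
  have := slope_lip t t01; rewrite p0 ler_norml => /andP[+ _]; lra.
- have := @first_order_le_quadratic (fun t => h (p t))
    (fun t => dot (G (p t)) d) (L * enorm d ^+ 2) remainder.
  rewrite p0 p1; apply => t t01; apply: le_trans (ler_norm _) _.
  by have := slope_lip t t01; rewrite p0.
Unshelve. all: by end_near.
Qed.

End QuadraticBounds.

(** * Bregman distances of strongly convex kernels *)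

Section Bregman.
Variables (R : realType) (n : nat).
Implicit Types (K : 'rV[R]_n -> R) (x y d : 'rV[R]_n).

Lemma dot_gradE K x d : differentiable K x -> dot (grad K x) d = 'D_d K x.
Proof.
move=> diffK; rewrite deriveE// [in RHS](row_sum_delta d) linear_sum.
apply: eq_bigr => i _.
by rewrite linearZ /= mxE deriveE// mulrC.
Qed.

(** Let [h] tend to zero from the right in the strong convexity inequality
    between [x] and [x + h *: (y - x)], divided by [h]. *)
Lemma bregman_ge mu K x y : differentiable K x -> strongly_convex mu K ->
  mu / 2 * enorm (y - x) ^+ 2 <= bregman K x y.
Proof.
move=> diffK scK; set d := y - x.
have quot_cvg : h^-1 *: (K (h *: d + x) - K x) @[h --> (0 : R)^'+] --> 'D_d K x.
  by apply: cvg_dnbhs_at_right; exact: diff_derivable.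
have bound_cvg : K y - K x - mu / 2 * ((1 - h) * enorm d ^+ 2)
    @[h --> (0 : R)^'+] --> K y - K x - mu / 2 * ((1 - 0) * enorm d ^+ 2).
  apply: cvgB; first exact: cvg_cst.
  apply: cvgM; first exact: cvg_cst.
  apply: cvgM; last exact: cvg_cst.
  apply: cvgB; first exact: cvg_cst.
  by apply: cvg_within_filter; exact: cvg_id.
have : 'D_d K x <= K y - K x - mu / 2 * ((1 - 0) * enorm d ^+ 2).
  apply: (ler_cvg_to quot_cvg bound_cvg).
  near=> h.
  have h0 : 0 < h by near: h; exact: nbhs_right_gt.
  have h1 : h <= 1 by near: h; exact: nbhs_right_le.
  have h01 : 0 <= h <= 1 by rewrite ltW.
  rewrite /GRing.scale /= mulrC ler_pdivrMr//.
  have -> : h *: d + x = h *: y + (1 - h) *: x.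
    by rewrite scalerBl scale1r scalerBr -addrA [- _ + x]addrC.
  by have := scK y x h h01; rewrite -/d; lra.
rewrite /bregman dot_gradE// -/d; lra.
Unshelve. all: by end_near.
Qed.

(** The two Bregman distances between [x] and [y] add up to the pairing of the
    gradient increment with [y - x], so each is at most that pairing as soon as
    the other one is nonnegative. *)
Lemma bregman_le mu M K x y : 0 <= mu -> (forall z, differentiable K z) ->
  strongly_convex mu K -> lipschitz_within M setT (grad K) ->
  bregman K x y <= M * enorm (y - x) ^+ 2.
Proof.
move=> mu0 diffK scK lipK.
have swap_ge0 : 0 <= bregman K y x.
  apply: le_trans (bregman_ge x (diffK y) scK).
  by rewrite mulr_ge0// ?sqr_ge0// divr_ge0.
have sumE : bregman K x y + bregman K y x
    = dot (grad K y - grad K x) (y - x).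
  by rewrite /bregman dotBl -[x - y]opprB dotNr; lra.
apply: (@le_trans _ _ (dot (grad K y - grad K x) (y - x))); first lra.
rewrite (le_trans (dot_le_enorm _ _))// expr2 mulrA ler_wpM2r ?enorm_ge0//.
exact: lipK.
Qed.

Lemma bregman_self K x : bregman K x x = 0.
Proof. by rewrite /bregman subrr dot0r addr0 subrr. Qed.

End Bregman.

(** * Lower semicontinuity and cluster points *)

Section ClusterPoints.
Variables (R : realType) (n : nat).
Implicit Types (psi f g : 'rV[R]_n -> \bar R) (p : 'rV[R]_n).
Implicit Types (u x : nat -> 'rV[R]_n) (C : set 'rV[R]_n).

Lemma lower_semicontinuousD f g :
  (forall y, -oo < f y)%E -> (forall y, -oo < g y)%E ->
  lower_semicontinuous f -> lower_semicontinuous g ->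
  lower_semicontinuous (f \+ g)%E.
Proof.
move=> fNy gNy lscf lscg p a a_lt.
(* Any level a below f p + g p splits as b + (a - b) with each part below the
   corresponding value. *)
have [b bf ag] : exists2 b : R, (b%:E < f p)%E & ((a - b)%:E < g p)%E.
  move: a_lt (fNy p) (gNy p) => /=.
  case: (f p) (g p) => [r| |] [s| |]//= a_lt _ _.
  - move: a_lt; rewrite -EFinD lte_fin => a_lt.
    by exists (r - (r + s - a) / 2); rewrite lte_fin; lra.
  - by exists (r - 1); rewrite ?ltry// lte_fin; lra.
  - by exists (a - s + 1); rewrite ?ltry// lte_fin; lra.
  - by exists a; rewrite ltry.
have [U pU Uf] := lscf _ _ bf; have [W pW Wg] := lscg _ _ ag.
exists (U `&` W); first exact: filterI.
move=> y [/Uf fy /Wg gy]; rewrite /= -[a](subrKC b) EFinD.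
exact: lteD.
Qed.

Lemma lower_semicontinuous_cvg_le psi p u (r : nat -> R) (l : R) :
  lower_semicontinuous psi -> u k @[k --> \oo] --> p ->
  r k @[k --> \oo] --> l ->
  (\forall k \near \oo, (psi (u k) <= (r k)%:E)%E) -> (psi p <= l%:E)%E.
Proof.
move=> lsc up rl psi_le; rewrite leNgt; apply/negP => l_lt.
have [a la ap] : exists2 a, l < a & (a%:E < psi p)%E.
  case: (psi p) l_lt => [s| |]//.
    by rewrite lte_fin => ls; exists ((l + s) / 2); rewrite ?lte_fin; lra.
  by move=> _; exists (l + 1); rewrite ?ltry//; lra.
have [U pU Ua] := lsc _ _ ap.
have : a <= l.
  apply: (cvgr_to_ge rl); near=> k.
  rewrite -lee_fin; apply: (@le_trans _ _ (psi (u k))).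
    by apply/ltW/Ua; near: k; exact: up.
  by near: k.
by rewrite leNgt la.
Unshelve. all: by end_near. Qed.

Lemma cluster_subsequence x p : cluster (x k @[k --> \oo]) p ->
  exists2 s : nat -> nat, (forall k, (k <= s k)%N) & x (s k) @[k --> \oo] --> p.
Proof.
move=> clp.
have step (k : nat) : exists j : nat, (k <= j)%N /\ enorm (x j - p) < k.+1%:R^-1.
  have : (x @ \oo) (x @` [set j | (k <= j)%N]).
    by exists k => // j /= kj; exists j.
  move=> /clp/(_ (near_enorm_lt p _))-/(_ k.+1%:R^-1).
  rewrite invr_gt0 ltr0n => /(_ isT)[_ [[j kj <-] xj]].
  by exists j.
have [s sP] := choice step; exists s => [k|]; first by case: (sP k).
have : enorm (x (s k) - p) @[k --> \oo] --> (0 : R).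
  apply: squeeze_cvgr; [|exact: cvg_cst|exact: cvg_harmonic].
  by near=> k; rewrite enorm_ge0 ltW//; case: (sP k).
move=> /enorm_cvg0 sub_cvg.
have : x (s k) - p + p @[k --> \oo] --> 0 + p.
  by apply: cvgD => //; exact: cvg_cst.
by rewrite add0r; under eq_fun do rewrite subrK.
Unshelve. all: by end_near. Qed.

(** Stated for an arbitrary proper filter so that it also applies to a sequence
    restricted to an infinite set of indices. *)
Lemma bounded_range_cluster T (F : set_system T) (FF : ProperFilter F)
    (u : T -> 'rV[R]_n) : bounded_set (range u) -> exists p, cluster (u @ F) p.
Proof.
move=> [M [Mreal boundM]].
have cpt : compact [set v : 'rV[R]_n | `|v| <= M + 1].
  apply: bounded_closed_compact.
    exists (M + 1); split; first exact: num_real.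
    by move=> N MN v /= /le_trans; apply; exact: ltW.
  apply: (@closed_comp _ _ (fun v : 'rV[R]_n => `|v|) [set t | t <= M + 1]).
    by move=> v _; exact: norm_continuous.
  exact: closed_le.
have [|p [_ pcl]] := cpt (u @ F); last by exists p.
apply: nearW => t; apply: boundM; first by rewrite ltrDl.
by exists t.
Qed.

(** Were the distance to stay above some [e] along infinitely many indices, the
    sequence restricted to these indices would still have a cluster point, and
    that point lies in [C]. *)
Lemma edistance_cvg0 x C : bounded_set (range x) ->
  (forall p, cluster (x k @[k --> \oo]) p -> C p) ->
  edistance (x k) C @[k --> \oo] --> 0%E.
Proof.
move=> bx clC.
have dist_ge0 k : (0 <= edistance (x k) C)%E.
  by apply/ereal_infP => _ [z _ <-]; rewrite lee_fin enorm_ge0.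
have dist_lt e : 0 < e -> \forall k \near \oo, (edistance (x k) C < e%:E)%E.
  move=> e0; apply: contrapT => nfar.
  pose S := [set k | ~ (edistance (x k) C < e%:E)%E].
  have FS : ProperFilter (within S \oo).
    apply: Build_ProperFilter => within0; apply: nfar.
    move: within0; rewrite /within /=.
    by apply: filterS => k Sk; apply: contrapT => /Sk.
  have [p clp] := bounded_range_cluster FS bx.
  have Cp : C p.
    apply: clC => U W xU pW; apply: clp pW.
    by move: xU; rewrite /fmap /within /=; apply: filterS => k Uk _; exact: Uk.
  have : (x @ within S \oo) (x @` S) by exists 0%N => // k _ Sk; exists k.
  move=> /clp/(_ (near_enorm_lt p e0)) [_ [[k Sk <-] xkp]].
  apply: Sk; apply: le_lt_trans (_ : ((enorm (x k - p))%:E < _)%E) => //.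
  by apply: ereal_inf_lbound; exists p.
apply/fine_cvgP; split.
  have := dist_lt 1 ltr01; apply: filterS => k dk.
  by rewrite ge0_fin_numE// (lt_trans dk)// ltry.
apply/cvgr0Pnorm_lt => e e0; have := dist_lt e e0; apply: filterS => k dk.
rewrite /= ger0_norm ?fine_ge0//.
by rewrite -lte_fin fineK// ge0_fin_numE// (lt_trans dk)// ltry.
Qed.

End ClusterPoints.

(** * Subdifferentials *)

Section Subdifferentials.
Variables (R : realType) (n : nat).
Implicit Types (f g psi : 'rV[R]_n -> \bar R) (p xi y : 'rV[R]_n).

(** The quadratic error of a proximal subgradient is of smaller order than the
    distance. *)
Lemma subdiffP_subF psi p : (-oo < psi p)%E ->
  subdiffP psi p `<=` subdiffF psi p.
Proof.
move=> psiNy xi [psi_lty [rho [eta [rho0 eta0 minorant]]]]; split=> //.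
rewrite limf_einfE; apply/lee_addgt0Pr => e e0.
rewrite -leeBlDr// sub0e -EFinN.
pose r := Num.min eta (e / rho).
have r0 : 0 < r by rewrite lt_min eta0 divr_gt0.
(* On a small enough punctured ball the quadratic error, divided by the
   distance, stays below e. *)
pose U := [set y | y != p /\ enorm (y - p) < r].
apply: (@le_trans _ _ (ereal_inf [set (enorm (y - p))^-1%:E *
    (psi y - psi p - (dot xi (y - p))%:E) | y in U]%E)); last first.
  apply: ereal_sup_ubound; exists U => //.
  rewrite /dnbhs /within /=; have := near_enorm_lt p r0.
  by apply: filterS => y yr yp.
apply/ereal_infP => _ [y [yp yr] <-].
move: yr; rewrite lt_min => /andP[/ltW y_eta y_e].
have d0 : 0 < enorm (y - p).
  by rewrite lt_neqAle enorm_ge0 andbT eq_sym enorm_eq0 subr_eq0.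
have := minorant y y_eta; move: psi_lty psiNy; rewrite /edom /=.
case: (psi p) => [s| |]// _ _; case: (psi y) => [t| |]//.
- rewrite -EFinD lee_fin => st; rewrite -!EFinB -EFinM lee_fin.
  rewrite ler_pdivlMl//.
  move: y_e; rewrite ltr_pdivlMr// => y_e; nra.
- by move=> _; rewrite !addye// gt0_muley ?lte_fin ?invr_gt0// leey.
Qed.

(** A Frechet subgradient is limiting along constant sequences. *)
Lemma subdiffF_subL psi p : subdiffF psi p `<=` subdiffL psi p.
Proof.
move=> xi xiF; split; first by case: xiF.
by exists (fun=> p), (fun=> xi); split=> //; exact: cvg_cst.
Qed.

Lemma subdiffP_subL psi p : (-oo < psi p)%E ->
  subdiffP psi p `<=` subdiffL psi p.
Proof. by move=> psiNy xi /(subdiffP_subF psiNy)/subdiffF_subL. Qed.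

Lemma quadratic_minorant_subdiffP psi p xi c : edom psi p -> 0 <= c ->
  (forall y, psi p <= psi y + (c * enorm (y - p) ^+ 2 - dot xi (y - p))%:E)%E ->
  subdiffP psi p xi.
Proof.
move=> dom_p c0 minorant; split=> //; exists (c + 1), 1; split=> // [|y _].
  by rewrite ltr_wpDl.
have -> : (dot xi (y - p) - (c + 1) * enorm (y - p) ^+ 2)%:E
    = (- ((c + 1) * enorm (y - p) ^+ 2 - dot xi (y - p))%:E)%E.
  by rewrite -EFinN opprB.
rewrite leeBlDr// (le_trans (minorant y))// leeD2l// lee_fin.
by have := sqr_ge0 (enorm (y - p)); nra.
Qed.

End Subdifferentials.

(** * Consequences of the minimality of a step *)

Section Step.
Variables (R : realType) (n : nat).
Implicit Types (f g : 'rV[R]_n -> \bar R) (gradf : 'rV[R]_n -> 'rV[R]_n).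
Implicit Types (x y z p : 'rV[R]_n).

Lemma vbpg_step_dom gradf g (D : 'rV[R]_n -> 'rV[R]_n -> R) (eps : R) x z :
  eproper g -> argmin (vbpg_objective gradf g D eps x) z -> edom g z.
Proof.
move=> [_ [y gy]] /(_ y); rewrite /edom /= /vbpg_objective.
move: gy; rewrite /edom /=; case: (g y) => [s| |]//; case: (g z) => [t| |]//.
all: by rewrite ?ltry ?ltNyr.
Qed.

Lemma vbpg_step_le gradf g (D : 'rV[R]_n -> 'rV[R]_n -> R) (eps : R) x z y :
  (-oo < g y)%E -> argmin (vbpg_objective gradf g D eps x) z ->
  (g z <= g y + (dot (gradf x) (y - z) + eps^-1 * (D x y - D x z))%:E)%E.
Proof.
move=> gNy /(_ y); rewrite /vbpg_objective.
have -> : dot (gradf x) (y - z) = dot (gradf x) (y - x) - dot (gradf x) (z - x).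
  by rewrite -dotBr opprB addrA subrK.
case: (g y) gNy => [s| |]// _; case: (g z) => [t| |]//=.
- by rewrite -!EFinD !lee_fin; lra.
- by move=> _; rewrite leNye.
- by move=> _; rewrite addye// leey.
Qed.

(** The hypothesis bounds [g] from below, around [p], by a quadratic with slope
    [- gradf p]; adding the lower half of the quadratic bound on [f] cancels the
    slope. *)
Lemma minorant_critical f gradf g L c p :
  @convex_set R 'rV[R]_n (edom f) -> (forall y, -oo < f y)%E ->
  (forall y, -oo < g y)%E -> gradient_on_dom f gradf -> 0 < L ->
  lipschitz_within L (edom f) gradf -> edom f p -> edom g p -> 0 <= c ->
  (forall y, g p <=
    g y + (dot (gradf p) (y - p) + c * enorm (y - p) ^+ 2)%:E)%E ->
  subdiffP g p (- gradf p) /\ prox_critical (f \+ g)%E p.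
Proof.
move=> cvxf fNy gNy gradfP L0 lipf dom_fp dom_gp c0 minorant; split.
  apply: (quadratic_minorant_subdiffP dom_gp c0) => y.
  by rewrite dotNl opprK [c * _ + _]addrC.
apply: (@quadratic_minorant_subdiffP _ _ _ _ _ (c + L / 2)) => [||y].
- by rewrite /edom /= lte_add_pinfty.
- by rewrite addr_ge0// divr_ge0// ltW.
rewrite dot0l subr0 /=.
have [fy|fy] := pselect (edom f y); last first.
  have -> : f y = +oo%E by apply/eqP; rewrite -leye_eq leNgt; exact/negP.
  have := gNy y; case: (g y) => [s| |]// _.
    by rewrite addye// leey.
  by rewrite addye// leey.
have := lipschitz_gradient_quadratic cvxf gradfP lipf dom_fp fy.
rewrite ler_norml => /andP[lower _].
have := minorant y; move: lower dom_fp fy dom_gp (fNy p) (fNy y) (gNy p) (gNy y).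
rewrite /edom /=.
case: (f p) => [a| |]//; case: (f y) => [b| |]//; case: (g p) => [s| |]//.
case: (g y) => [t| |]//=; last first.
  by move=> *; rewrite ?addey// ?addye// leey.
move=> lower _ _ _ _ _ _ _; rewrite -!EFinD !lee_fin => st; lra.
Qed.

Variables (f g : 'rV[R]_n -> \bar R) (gradf : 'rV[R]_n -> 'rV[R]_n).
Variables (K : 'rV[R]_n -> R) (L mu M eps : R) (x z : 'rV[R]_n).
Hypothesis diffK : forall y, differentiable K y.
Hypothesis mu_gt0 : 0 < mu.
Hypothesis scK : strongly_convex mu K.
Hypothesis eps_gt0 : 0 < eps.
Hypothesis gNy : forall y, (-oo < g y)%E.
Hypothesis z_min : argmin (vbpg_objective gradf g (bregman K) eps x) z.

(** Minimality against an arbitrary competitor [y], with the kernel only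
    present through its Lipschitz constant.  The absolute value keeps the
    coefficient nonnegative even in dimension zero, where a Lipschitz constant
    may be negative. *)
Lemma vbpg_step_minorant (elow : R) y : 0 < elow <= eps ->
  lipschitz_within M setT (grad K) ->
  (g z <= g y + (dot (gradf x) (y - z)
                 + `|M| / elow * enorm (y - x) ^+ 2)%:E)%E.
Proof.
move=> /andP[elow0 elow_le] lipK.
apply: le_trans (vbpg_step_le (gNy y) z_min) _.
rewrite leeD2l// lee_fin lerD2l.
have Dz : 0 <= bregman K x z.
  apply: le_trans (bregman_ge z (diffK x) scK).
  by rewrite mulr_ge0 ?sqr_ge0// divr_ge0// ltW.
have Dy : bregman K x y <= `|M| * enorm (y - x) ^+ 2.
  apply: le_trans (bregman_le x y (ltW mu_gt0) diffK scK lipK) _.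
  by rewrite ler_wpM2r ?sqr_ge0// ler_norm.
have inv_le : eps^-1 <= elow^-1 by rewrite lef_pV2.
have inv_ge0 : 0 <= eps^-1 by rewrite invr_ge0 ltW.
apply: (@le_trans _ _ (eps^-1 * (`|M| * enorm (y - x) ^+ 2))).
  by rewrite ler_wpM2l//; lra.
rewrite [`|M| / elow]mulrC -mulrA ler_wpM2r//.
by rewrite mulr_ge0// sqr_ge0.
Qed.

(** Comparing with the competitor [x] itself: strong convexity of the kernel
    outweighs the curvature of [f]. *)
Lemma vbpg_step_decrease (m ebar : R) :
  @convex_set R 'rV[R]_n (edom f) -> (forall y, -oo < f y)%E ->
  gradient_on_dom f gradf -> lipschitz_within L (edom f) gradf ->
  edom f x -> edom f z -> 0 < m <= mu -> eps <= ebar ->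
  ((f z + g z) + ((m / ebar - L) / 2 * enorm (z - x) ^+ 2)%:E <= f x + g x)%E.
Proof.
move=> cvxf fNy gradfP lipf fx fz /andP[m0 m_le] eps_le.
have := lipschitz_gradient_quadratic cvxf gradfP lipf fx fz.
rewrite ler_norml => /andP[_ upper].
have := vbpg_step_le (gNy x) z_min; rewrite bregman_self sub0r.
rewrite -[x - z]opprB dotNr.
have Dz : m / 2 * enorm (z - x) ^+ 2 <= bregman K x z.
  apply: le_trans (bregman_ge z (diffK x) scK).
  by rewrite ler_wpM2r ?sqr_ge0// ler_wpM2r.
have inv_ge : ebar^-1 <= eps^-1 by rewrite lef_pV2// posrE (lt_le_trans eps_gt0).
have D_eps : ebar^-1 * (m / 2 * enorm (z - x) ^+ 2) <= eps^-1 * bregman K x z.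
  apply: ler_pM => //; first by rewrite invr_ge0 (le_trans (ltW eps_gt0)).
  by rewrite mulr_ge0 ?sqr_ge0// divr_ge0// ltW.
move: upper fx fz (fNy x) (fNy z) (gNy x) (gNy z); rewrite /edom /=.
case: (f x) => [a| |]//; case: (f z) => [b| |]//.
case: (g x) => [s| |]//; case: (g z) => [t| |]//=.
- by move=> upper _ _ _ _ _ _; rewrite -!EFinD !lee_fin; lra.
- by move=> *; rewrite addey// leey.
Qed.

End Step.

(** * Passing to the limit along the iterates *)

Section Limits.
Variables (R : realType) (n : nat).

(** The sums of [c * a] telescope against the decrease of [b], which is bounded
    below. *)
Lemma descent_summable (a b : nat -> R) (c B : R) :
  0 < c -> (forall k, 0 <= a k) -> (forall k, b k.+1 + c * a k <= b k) ->
  (forall k, B <= b k) ->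
  (\sum_(0 <= k <oo) (a k)%:E < +oo)%E /\ a k @[k --> \oo] --> 0.
Proof.
move=> c0 a0 step lower.
have partial_le N : \sum_(0 <= k < N) a k <= (b 0 - B) / c.
  rewrite ler_pdivlMr//; apply: (@le_trans _ _ (b 0 - b N)); last first.
    by rewrite lerD2l lerN2.
  elim: N => [|N IH]; first by rewrite big_nil mul0r subrr.
  by rewrite big_nat_recr//= mulrDl; have := step N; lra.
split.
  apply: (@le_lt_trans _ _ ((b 0 - B) / c)%:E); last exact: ltry.
  apply: lime_le.
    by apply: is_cvg_nneseries => k _ _; rewrite lee_fin.
  by apply: nearW => N; rewrite sumEFin lee_fin.
apply: cvg_series_cvg_0; apply: nondecreasing_is_cvgn.
  by apply: nondecreasing_series => k _ _.
exists ((b 0 - B) / c) => _ [N _ <-]; exact: partial_le.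
Qed.

(** Along a subsequence of [x] tending to [p] the successors tend to [p] too, so
    every term on the right converges and lower semicontinuity handles the
    left. *)
Lemma cluster_minorant (g : 'rV[R]_n -> \bar R) (G : 'rV[R]_n -> 'rV[R]_n)
    (A : set 'rV[R]_n) (L c : R) (x : nat -> 'rV[R]_n) p :
  lower_semicontinuous g -> (forall y, -oo < g y)%E -> lipschitz_within L A G ->
  (forall k, A (x k)) -> A p ->
  (forall k y, g (x k.+1) <= g y + (dot (G (x k)) (y - x k.+1)
                                    + c * enorm (y - x k) ^+ 2)%:E)%E ->
  enorm (x k - x k.+1) @[k --> \oo] --> (0 : R) ->
  cluster (x k @[k --> \oo]) p ->
  forall y, (g p <= g y + (dot (G p) (y - p) + c * enorm (y - p) ^+ 2)%:E)%E.
Proof.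
move=> lscg gNy lipG Ax Ap step steps0 /cluster_subsequence[s s_ge sub_p] y.
have s_oo : s k @[k --> \oo] --> \oo.
  by apply/cvgnyPge => N; exists N => // k /= /leq_trans; apply.
have gap0 : x (s k) - x (s k).+1 @[k --> \oo] --> (0 : 'rV[R]_n).
  apply: enorm_cvg0.
  exact: (cvg_comp s (fun k => enorm (x k - x k.+1)) s_oo steps0).
have succ_p : x (s k).+1 @[k --> \oo] --> p.
  have : x (s k) - (x (s k) - x (s k).+1) @[k --> \oo] --> p - 0.
    by apply: cvgB.
  by rewrite subr0; under eq_fun do rewrite subKr.
have G_p : G (x (s k)) @[k --> \oo] --> G p.
  have : G (x (s k)) - G p + G p @[k --> \oo] --> 0 + G p.
    apply: cvgD; last exact: cvg_cst.
    apply: enorm_cvg0.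
    apply: (@squeeze_cvgr _ _ _ _ (fun=> 0) (fun k => L * enorm (x (s k) - p))).
    - by apply: nearW => k; rewrite enorm_ge0/=; exact: lipG.
    - exact: cvg_cst.
    - rewrite -[0](mulr0 L) -[X in L * X](@enorm0 R n) -(subrr p).
      apply: cvgM; first exact: cvg_cst.
      by apply: cvg_enorm; apply: cvgB => //; exact: cvg_cst.
  by rewrite add0r; under eq_fun do rewrite subrK.
case gyE: (g y) (gNy y) => [t| |]// _; last by rewrite addye// leey.
apply: (lower_semicontinuous_cvg_le (r := fun k =>
  t + (dot (G (x (s k))) (y - x (s k).+1) + c * enorm (y - x (s k)) ^+ 2))
  lscg succ_p).
  apply: cvgD; first exact: cvg_cst.
  apply: cvgD.
    by apply: cvg_dot => //; apply: cvgB => //; exact: cvg_cst.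
  apply: cvgM; first exact: cvg_cst.
  by apply: cvgM; apply: cvg_enorm; apply: cvgB => //; exact: cvg_cst.
by apply: nearW => k; have := step (s k) y; rewrite gyE.
Qed.

End Limits.

(** * The convergence theorem *)

Theorem proposition4p1 (R : realType) (n : nat)
  (f g : 'rV[R]_n -> \bar R) (gradf : 'rV[R]_n -> 'rV[R]_n)
  (K : nat -> 'rV[R]_n -> R) (L m M elow ebar : R)
  (mk Mk eps : nat -> R) (x : nat -> 'rV[R]_n)
  (* assumptions on f *)
  (f_proper : eproper f)
  (f_lsc : lower_semicontinuous f)
  (f_convex_dom : @convex_set R 'rV[R]_n (edom f))
  (f_grad : gradient_on_dom f gradf)
  (L_gt0 : 0 < L)
  (f_smooth : lipschitz_within L (edom f) gradf)
  (* assumptions on g *)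
  (g_proper : eproper g)
  (g_lsc : lower_semicontinuous g)
  (g_cont : {within edom g, continuous g})
  (g_convex_dom : @convex_set R 'rV[R]_n (edom g))
  (* assumption on F *)
  (F_level : level_bounded (f \+ g)%E)
  (* Bregman kernels *)
  (m_gt0 : 0 < m)
  (mk_ge : forall k, m <= mk k)
  (Mk_le : forall k, Mk k <= M)
  (K_diff : forall k y, differentiable (K k) y)
  (K_sc : forall k, strongly_convex (mk k) (K k))
  (K_smooth : forall k, lipschitz_within (Mk k) setT (grad (K k)))
  (* step sizes *)
  (elow_gt0 : 0 < elow)
  (eps_bounds : forall k, elow <= eps k <= ebar)
  (ebar_lt : ebar < m / L)
  (* the sequence generated by the method *)
  (x_vbpg : vbpg f gradf g (fun k => bregman (K k)) eps x) :
  let F := (f \+ g)%E in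
  [/\ (* (i) *)
      (forall k, ~ prox_critical F (x k)) ->
        decreasing_seq (fun k => F (x k)),
      (* (ii) *)
      (\sum_(0 <= k <oo) (enorm (x k - x k.+1) ^+ 2)%:E < +oo)%E,
      (* (iii) *)
      bounded_set (range x) /\
        (forall xbar, cluster (x k @[k --> \oo]) xbar -> subdiffL F xbar 0),
      (* (iv) *)
      edistance (x k) (lim_critical f gradf g) @[k --> \oo] --> 0%E &
      (* (v) *)
      forall (D : 'rV[R]_n -> 'rV[R]_n -> R) (ehat : R),
        (forall k y z, bregman (K k) y z = D y z) ->
        elow < ehat < m / (2 * L) ->
        eps k @[k --> \oo] --> ehat ->
        (forall xbar, cluster (x k @[k --> \oo]) xbar -> prox_critical F xbar) /\
        (edistance (x k) (prox_critical F) @[k --> \oo] --> 0%E)].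
Proof.
move=> F; have [fNy _] := f_proper; have [gNy _] := g_proper.
have FNy y : (-oo < F y)%E.
  by rewrite /F /= lteNye adde_eq_ninfty !negb_or -!lteNye fNy gNy.
have dom_f k : edom f (x k) by case: (x_vbpg k).
have step_min k := (x_vbpg k).2.
have dom_g k : edom g (x k.+1) := vbpg_step_dom g_proper (step_min k).
have eps_gt0 k : 0 < eps k.
  by apply: lt_le_trans elow_gt0 _; have /andP[] := eps_bounds k.
have mk_gt0 k : 0 < mk k := lt_le_trans m_gt0 (mk_ge k).
have ebar_gt0 : 0 < ebar.
  by apply: lt_le_trans (eps_gt0 0) _; have /andP[] := eps_bounds 0.
pose d k := enorm (x k - x k.+1).
pose c := (m / ebar - L) / 2.
have c_gt0 : 0 < c.
  by rewrite divr_gt0// subr_gt0 ltr_pdivlMr// mulrC -ltr_pdivlMr.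
have descent k : (F (x k.+1) + (c * d k ^+ 2)%:E <= F (x k))%E.
  have /andP[_ eps_le] := eps_bounds k.
  rewrite /d enorm_distC; apply: (vbpg_step_decrease (K_diff k)
    (K_sc k) (eps_gt0 k) gNy (step_min k)) => //.
  by rewrite m_gt0 mk_ge.
(* One constant serves all the steps, since 1 / eps k <= 1 / elow. *)
pose C := `|M| / elow.
have C_ge0 : 0 <= C by rewrite divr_ge0// ltW.
have minorant k y : (g (x k.+1) <= g y + (dot (gradf (x k)) (y - x k.+1)
                                   + C * enorm (y - x k) ^+ 2)%:E)%E.
  have /andP[elow_le _] := eps_bounds k.
  apply: (vbpg_step_minorant (K_diff k) (mk_gt0 k) (K_sc k)
    (eps_gt0 k) gNy (step_min k)); first by rewrite elow_gt0.
  move=> y1 y2 _ _; apply: le_trans (K_smooth k _ _ I I) _ => //.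
  by rewrite ler_wpM2r ?enorm_ge0.
have F_fin k : F (x k.+1) \is a fin_num.
  rewrite fin_numElt FNy /F /=; apply: lte_add_pinfty; last exact: dom_g.
  exact: dom_f.
pose b k := fine (F (x k.+1)).
have bE k : F (x k.+1) = (b k)%:E by rewrite fineK.
have b_step k : b k.+1 + c * d k.+1 ^+ 2 <= b k.
  by rewrite -lee_fin EFinD -!bE; exact: descent.
have b_noninc : nonincreasing_seq b.
  apply/nonincreasing_seqP => k; apply: le_trans (b_step k).
  by rewrite lerDl mulr_ge0 ?sqr_ge0// ltW.
have bx : bounded_set (range x).
  have [B [Breal boundB]] := F_level (b 0).
  exists (Num.max B `|x 0|); split; first exact: num_real.
  move=> N; rewrite gt_max => /andP[BN x0N] _ [[|k] _ <-]; first exact: ltW.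
  have : (F (x k.+1) <= (b 0)%:E)%E by rewrite bE lee_fin b_noninc.
  exact: boundB.
have F_lsc := lower_semicontinuousD fNy gNy f_lsc g_lsc.
(* The values are nonincreasing and F is lower semicontinuous, so its value at a
   cluster point is a lower bound for all of them. *)
have F_cluster p k : cluster (x k @[k --> \oo]) p -> (F p <= (b k)%:E)%E.
  move=> /cluster_subsequence[s s_ge sub_p].
  apply: (lower_semicontinuous_cvg_le F_lsc sub_p (cvg_cst (b k))).
  exists k.+1 => // j /= kj; have := leq_trans kj (s_ge j).
  case: (s j) => // i; rewrite ltnS => ki.
  by have : (F (x i.+1) <= (b k)%:E)%E by rewrite bE lee_fin b_noninc.
have [b_summable d_cvg0] :
    (\sum_(0 <= k <oo) (d k.+1 ^+ 2)%:E < +oo)%E /\ d k @[k --> \oo] --> (0 : R).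
  have [p clp] := bounded_range_cluster eventually_filter bx.
  have b_lower k : fine (F p) <= b k.
    have Fp := F_cluster p k clp.
    rewrite -lee_fin fineK// fin_numElt FNy/=; exact: le_lt_trans Fp (ltry _).
  have [sum_lt d2_cvg] := descent_summable c_gt0 (fun k => sqr_ge0 (d k.+1))
    b_step b_lower.
  split=> //; rewrite -cvg_shiftS /=.
  have : Num.sqrt (d k.+1 ^+ 2) @[k --> \oo] --> Num.sqrt (0 : R).
    by apply: cvg_comp d2_cvg _; exact: sqrt_continuous.
  by rewrite sqrtr0; under eq_fun do rewrite sqrtr_sqr ger0_norm ?enorm_ge0//.
have cluster_critical p : cluster (x k @[k --> \oo]) p ->
    [/\ edom f p, subdiffP g p (- gradf p) & prox_critical F p].
  move=> clp.
  have Fp : (F p < +oo)%E := le_lt_trans (F_cluster p 0 clp) (ltry _).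
  have [fp gp] : edom f p /\ edom g p.
    move: Fp (fNy p) (gNy p); rewrite /F /edom /=.
    by case: (f p) => [s| |]//; case: (g p) => [t| |]//; rewrite !ltry.
  have := cluster_minorant g_lsc gNy f_smooth dom_f fp minorant d_cvg0 clp.
  by move=> /(minorant_critical f_convex_dom fNy gNy f_grad L_gt0 f_smooth
    fp gp C_ge0)[].
split.
(* A step that stays in place makes the minorant touch g at x k, and then x k is
   critical; every other step strictly decreases F. *)
- move=> not_crit; apply/decreasing_seqP => k.
  have moved : 0 < d k.
    rewrite lt_neqAle enorm_ge0 andbT eq_sym enorm_eq0 subr_eq0.
    apply/eqP => fixed; apply: (not_crit k).
    have gk : edom g (x k) by rewrite fixed.
    apply: (minorant_critical f_convex_dom fNy gNy f_grad L_gt0 f_smooth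
      (dom_f k) gk C_ge0 _).2 => y.
    by have := minorant k y; rewrite -fixed.
  apply: lt_le_trans (descent k).
  by rewrite bE -EFinD lte_fin ltrDl mulr_gt0// exprn_gt0.
- rewrite nneseries_recl => [|k _|//]; last by rewrite lee_fin sqr_ge0.
  rewrite lte_add_pinfty ?ltry// -nneseries_addn => [|k].
    by under eq_eseriesr do rewrite addn1.
  by rewrite lee_fin sqr_ge0.
- split=> // p /cluster_critical[_ _]; exact: subdiffP_subL.
- apply: edistance_cvg0 => // p /cluster_critical[fp gp _]; split=> //.
  by exists (- gradf p); [exact: subdiffP_subL gp|rewrite subrr].
- move=> D ehat _ _ _; split=> [p /cluster_critical[]//|].
  by apply: edistance_cvg0 => // p /cluster_critical[].
Qed.
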